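(* Let $\mathcal{A}=\{0,1,\ldots,a-1\}$ be an alphabet of size $a$, let $n\ge 1$ be an integer, and let $u$ be a cyclic partial word over $\mathcal{A}$ of length $|u|\ge n$. Let $S$ be the set of words in $\mathcal{A}^n$ covered by $u$. Suppose that $u$ covers each word in $S$ exactly once and that every $n$-window of $u$ contains exactly one $\diamond$. Let $k$ be the total number of $\diamond$'s in $u$, so $k=|u|/n$. Let $v$ be the $(a,1,k)$-perfect necklace $v=0^k1^k\cdots(a-1)^k$. Then replacing the $\diamond$'s of $u^a$ with the letters of $v$, in order, yields a cyclic total word $w$ (a cyclic word with no $\diamond$) that also covers each word in $S$ exactly once.
   Context: $\diamond\notin\mathcal{A}$ is a wildcard symbol. A cyclic partial word over $\mathcal{A}$ is a cyclic sequence over $\mathcal{A}\cup\{\diamond\}$, indices being read modulo its length; fix a linear representation $u=u_0\cdots u_{|u|-1}$. An $n$-window of $u$ is a sequence of $n$ consecutive symbols $u_iu_{i+1}\cdots u_{i+n-1}$ (read cyclically). The cyclic partial word $u$ covers a word $z\in\mathcal{A}^n$ at position $i$ if $z$ is obtained from the $n$-window starting at $i$ by replacing each $\diamond$ by some letter of $\mathcal{A}$; ''exactly once'' means at exactly one position. For a word $c$, $c^m$ denotes the concatenation of $m$ copies of $c$; $u^a$ is regarded as a cyclic partial word of length $a|u|$, and it has $ak$ $\diamond$'s, the same as the length of $v$. An $(a,n,t)$-perfect necklace is a cyclic word $v$ of length $ta^n$ over $\{0,\ldots,a-1\}$ such that, for every residue $j$ modulo $t$, each word of $\{0,\ldots,a-1\}^n$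 equals $v_i\cdots v_{i+n-1}$ for a unique index $i$ modulo $ta^n$ with $i\equiv j \pmod t$. *)

(* Defs.v *)
From mathcomp Require Import all_boot.

Set Implicit Arguments.
Unset Strict Implicit.
Unset Printing Implicit Defensive.

(* A cyclic partial word is given by a linear representation; [None] is the
   wildcard. *)
Definition pword (a : nat) := seq (option 'I_a).

(* Indices are reduced modulo the length, so a window may wrap around. *)
Definition window (a n : nat) (u : pword a) (i : nat) : n.-tuple (option 'I_a) :=
  [tuple nth None u ((i + j) %% size u) | j < n].

Definition covers_at (a n : nat) (u : pword a) (z : n.-tuple 'I_a) (i : nat) : bool :=
  [forall j : 'I_n,
     (tnth (window n u i) j == None) || (tnth (window n u i) j == Some (tnth z j))].

Definition covers_once (a n : nat) (u : pword a) (z : n.-tuple 'I_a) : Prop :=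
  exists! i : 'I_(size u), covers_at u z i.

Definition covered (a n : nat) (u : pword a) : {set n.-tuple 'I_a} :=
  [set z | [exists i : 'I_(size u), covers_at u z i]].

Definition word_pow (T : Type) (m : nat) (c : seq T) : seq T :=
  flatten (nseq m c).

(* If [v] is too short, the remaining wildcards are kept; letters of [v] in
   excess are ignored. *)
Fixpoint fill (a : nat) (u : pword a) (v : seq 'I_a) : pword a :=
  match u, v with
  | [::], _ => [::]
  | Some x :: u', _ => Some x :: fill u' v
  | None :: u', [::] => None :: fill u' [::]
  | None :: u', c :: v' => Some c :: fill u' v'
  end.

Definition total_word (a : nat) (u : pword a) : bool := None \notin u.

Definition perfect_necklace (a n t : nat) (v : seq 'I_a) : Prop :=
  size v = t * a ^ n /\
  forall (j : 'I_t) (z : n.-tuple 'I_a),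
    exists! i : 'I_(size v),
      (i = j %[mod t]) /\ window n (map Some v) i = map_tuple Some z.

(* 0^k 1^k ... (a-1)^k; [enum 'I_a] lists 0, ..., a-1 in increasing order. *)
Definition blocks (a k : nat) : seq 'I_a :=
  flatten [seq word_pow k [:: c] | c <- enum 'I_a].

(* Main.v *)
Require Import Defs.
From mathcomp Require Import all_boot.

Set Implicit Arguments.
Unset Strict Implicit.
Unset Printing Implicit Defensive.

(** The necklace [v] has one block of [k] equal letters per copy of [u] in
    [u^a], and a copy of [u] has exactly [k] wildcards.  So the wildcards of the
    copy number [c] all receive the letter [c], and [w] is the concatenation
    over [c = 0, ..., a-1] of the total words [u[c]], where [u[c]] is [u] with
    every wildcard replaced by [c] ([fill_word_pow_blocks]).  Hence the letter
    of [w] at index [x] is that of [u] at [x] modulo [|u|], or, if that is a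
    wildcard, the number [x / |u|] modulo [a] of the copy in which [x] falls
    ([nth_fill]).

    Let [z] be covered by [u], at the unique position [i], and let [j] be the
    place of the only wildcard in the window at [i].  A position [q] at which
    [w] covers [z] must reduce to [i] modulo [|u|], so [q = m |u| + i] with
    [m < a].  The letters other than the one at [j] then agree with [z], and the
    remaining condition is that the copy containing [q + j] has number [z_j].
    That copy is [m + e] modulo [a], where the carry [e = (i + j) / |u|] does
    not depend on [m], so exactly one [m] works.

    The equality [k n = |u|] counts in two ways the pairs formed by a window and
    a wildcard in it. *)

(** * Index arithmetic and concatenations of blocks *)

Lemma eq_divn_modn d x y : x %/ d = y %/ d -> x = y %[mod d] -> x = y.
Proof. by move=> Eq Er; rewrite (divn_eq x d) (divn_eq y d) Eq Er. Qed.

Lemma addn_modn_unique a e c : c < a ->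
  exists2 m, m < a & (m + e) %% a = c /\
    forall m', m' < a -> (m' + e) %% a = c -> m' = m.
Proof.
move=> c_lt; have a_gt0 : 0 < a by apply: leq_ltn_trans c_lt.
pose m := (c + (a - e %% a)) %% a.
have mP : (m + e) %% a = c.
  rewrite modnDml -modnDmr -addnA subnK; last by rewrite ltnW ?ltn_pmod.
  by rewrite modnDr modn_small.
exists m; first exact: ltn_pmod.
split=> // m' m'_lt m'P.
have /eqP : m' + e == m + e %[mod a] by rewrite m'P mP.
by move/eqP; rewrite eqn_modDr !modn_small ?ltn_pmod // => /eqP.
Qed.

Lemma sum_shift_modn L j (F : nat -> nat) :
  \sum_(i < L) F ((i + j) %% L) = \sum_(i < L) F i.
Proof.
case: L => [|L]; first by rewrite !big_ord0.
pose h (i : 'I_L.+1) : 'I_L.+1 := Ordinal (ltn_pmod (i + j) (ltn0Sn L)).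
have h_inj : injective h.
  move=> i1 i2 /(congr1 val) /= /eqP; rewrite eqn_modDr !modn_small //.
  by move/eqP/val_inj.
by rewrite [RHS](reindex_inj h_inj).
Qed.

Section Blocks.
Variables (T : Type) (a L : nat) (f : 'I_a -> seq T).
Hypothesis size_f : forall c, size (f c) = L.

Lemma size_flatten_enum : size (flatten [seq f c | c <- enum 'I_a]) = a * L.
Proof.
have sz s : size (flatten [seq f c | c <- s]) = size s * L.
  by elim: s => //= c s IH; rewrite size_cat size_f IH mulSn.
by rewrite sz size_enum_ord.
Qed.

Lemma nth_flatten_enum (x0 : T) (c : 'I_a) r : r < L ->
  nth x0 (flatten [seq f c | c <- enum 'I_a]) (c * L + r) = nth x0 (f c) r.
Proof.
move=> r_lt.
have nthE s m : m < size s ->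
    nth x0 (flatten [seq f c | c <- s]) (m * L + r) = nth x0 (f (nth c s m)) r.
  elim: s m => //= d s IH [|m] m_lt; rewrite nth_cat size_f.
    by rewrite mul0n add0n r_lt.
  by rewrite mulSn -addnA ltnNge leq_addr /= addKn IH.
by rewrite nthE ?size_enum_ord // nth_ord_enum.
Qed.

End Blocks.

Lemma word_pow1 (T : Type) k (c : T) : word_pow k [:: c] = nseq k c.
Proof. by rewrite /word_pow; elim: k => //= k ->. Qed.

(** * Covering at a position *)

Lemma covers_atP a n (y : pword a) (z : n.-tuple 'I_a) q :
  reflect (forall j : 'I_n, let o := nth None y ((q + j) %% size y) in
             o = None \/ o = Some (tnth z j))
          (covers_at y z q).
Proof.
apply: (iffP forallP) => H j; move: (H j); rewrite tnth_mktuple.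
  by case/orP=> /eqP; [left | right].
by case=> ->; rewrite eqxx ?orbT.
Qed.

Lemma covers_at_modn a n (y : pword a) (z : n.-tuple 'I_a) q :
  covers_at y z (q %% size y) = covers_at y z q.
Proof.
by apply/covers_atP/covers_atP => H j; move: (H j); rewrite modnDml.
Qed.

(** * The filled word *)

Lemma fill_cat a (u u' : pword a) v v' : size v = count_mem None u ->
  fill (u ++ u') (v ++ v') = fill u v ++ fill u' v'.
Proof.
elim: u v => [|[x|] u IH] v /=; first by move/size0nil->.
  by rewrite add0n => /IH->.
by case: v => // c v [] /IH /= ->.
Qed.

Definition fill_const a (u : pword a) (c : 'I_a) : pword a :=
  [seq Some (odflt c o) | o <- u].

Lemma fill_nseq a (u : pword a) (c : 'I_a) :
  fill u (nseq (count_mem None u) c) = fill_const u c.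
Proof. by elim: u => [|[x|] u IH] //=; rewrite ?add0n IH. Qed.

(** Each block of the necklace has as many letters as [u] has wildcards, so the
    filling never straddles two copies of [u]. *)
Lemma fill_word_pow_blocks a (u : pword a) :
  fill (word_pow a u) (blocks a (count_mem None u)) =
  flatten [seq fill_const u c | c <- enum 'I_a].
Proof.
set k := count_mem None u.
have fill_copies (s : seq 'I_a) :
    fill (word_pow (size s) u) (flatten [seq word_pow k [:: c] | c <- s]) =
    flatten [seq fill_const u c | c <- s].
  elim: s => //= c s IH.
  by rewrite -fill_nseq -IH /= word_pow1 fill_cat ?size_nseq.
by rewrite -fill_copies size_enum_ord.
Qed.

Section Filled.
Variables (a : nat) (u : pword a).
Let L := size u.
Let w := fill (word_pow a u) (blocks a (count_mem None u)).

Lemma size_fill_const c : size (fill_const u c) = L.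
Proof. exact: size_map. Qed.

Lemma size_fill : size w = a * L.
Proof.
by rewrite /w fill_word_pow_blocks (size_flatten_enum size_fill_const).
Qed.

Lemma total_fill : total_word w.
Proof.
rewrite /total_word /w fill_word_pow_blocks.
by apply/flatten_mapP=> -[c _ /mapP[o _]].
Qed.

Lemma nth_fill x : 0 < a -> 0 < L -> exists2 c : 'I_a, (x %/ L) %% a = c &
  nth None w (x %% size w) = Some (odflt c (nth None u (x %% L))).
Proof.
move=> a_gt0 L_gt0; exists (Ordinal (ltn_pmod (x %/ L) a_gt0)) => //.
set c := Ordinal _; have r_lt : x %% L < L by exact: ltn_pmod.
have -> : x %% size w = c * L + x %% L.
  by rewrite size_fill /= modn_divl {1}(divn_eq (x %% (a * L)) L) modn_dvdm
    ?dvdn_mull.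
rewrite /w fill_word_pow_blocks (nth_flatten_enum size_fill_const) //.
by rewrite (nth_map None).
Qed.

(** Outside the wildcards [w] repeats [u], and at a wildcard its letter is the
    number of the copy of [u].  This separates the condition on [q] modulo [|u|]
    from the one that selects a copy. *)
Lemma covers_at_fill n (z : n.-tuple 'I_a) q : 0 < a -> 0 < L ->
  covers_at w z q <->
  covers_at u z q /\
  forall j : 'I_n, nth None u ((q + j) %% L) = None ->
    ((q + j) %/ L) %% a = tnth z j.
Proof.
move=> a_gt0 L_gt0; split=> [/covers_atP w_q | [/covers_atP u_q copy]].
  split=> [|j]; [apply/covers_atP=> j /= |]; move: (w_q j) => /=;
    have [c cE ->] := nth_fill (q + j) a_gt0 L_gt0; case=> //.
    by rewrite -/L; case: (nth _ _ _) => [x|] H; [right | left].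
  by move=> + N; rewrite N cE => -[<-].
apply/covers_atP=> j /=; right.
have [c cE ->] := nth_fill (q + j) a_gt0 L_gt0.
case: (u_q j); rewrite -/L => N; rewrite N //=.
by congr Some; apply: val_inj; rewrite /= -cE copy.
Qed.

End Filled.

(** * Windows with a single wildcard *)

Lemma count_window a n (u : pword a) i :
  count_mem None (window n u i) =
  \sum_(j < n) (nth None u ((i + j) %% size u) == None).
Proof.
rewrite -sum1_count big_mkcond big_tuple; apply: eq_bigr => j _.
by rewrite tnth_mktuple; case: (nth _ _ _).
Qed.

Lemma count_mem_nth a (u : pword a) :
  count_mem None u = \sum_(i < size u) (nth None u i == None).
Proof.
rewrite -sum1_count big_mkcond (big_nth None) big_mkord.
by apply: eq_bigr => i _; case: (nth _ _ _).
Qed.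

(** Double counting: a wildcard lies in [n] windows, once for each place [j] in
    the window. *)
Lemma count_wildcards a n (u : pword a) :
  (forall i : 'I_(size u), count_mem None (window n u i) = 1) ->
  count_mem None u * n = size u.
Proof.
move=> u_window.
transitivity (\sum_(i < size u) count_mem None (window n u i)).
  under eq_bigr => i _ do rewrite count_window.
  rewrite exchange_big /=.
  under eq_bigr => j _ do
    rewrite (sum_shift_modn _ j (fun x => nth None u x == None)) -count_mem_nth.
  by rewrite sum_nat_const card_ord mulnC.
by under eq_bigr => i _ do rewrite u_window; rewrite sum1_card card_ord.
Qed.

Lemma window_wildcard a n (u : pword a) i : count_mem None (window n u i) = 1 ->
  exists j0 : 'I_n, forall j : 'I_n,
    (nth None u ((i + j) %% size u) == None) = (j == j0).
Proof.
rewrite count_window -big_mkcond sum1_card => /mem_card1[j0 j0P].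
by exists j0 => j; have := j0P j; rewrite !inE.
Qed.

(** * The necklace *)

Lemma blocks_perfect a k : perfect_necklace 1 k (blocks a k).
Proof.
have size_f (c : 'I_a) : size (word_pow k [:: c]) = k.
  by rewrite word_pow1 size_nseq.
have size_v : size (blocks a k) = a * k by exact: size_flatten_enum size_f.
split=> [|j z]; first by rewrite size_v expn1 mulnC.
have k_gt0 : 0 < k by apply: leq_ltn_trans (ltn_ord j).
have nthE (c : 'I_a) r : r < k -> nth c (blocks a k) (c * k + r) = c.
  by move=> r_lt; rewrite (nth_flatten_enum size_f) // word_pow1 nth_nseq r_lt.
have windowE (i : 'I_(size (blocks a k))) :
    window 1 (map Some (blocks a k)) i = map_tuple Some z <->
    i %/ k = tnth z ord0.
  have d_lt : i %/ k < a by rewrite ltn_divLR // -size_v.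
  have nth_i : nth None (map Some (blocks a k)) i = Some (Ordinal d_lt).
    rewrite (nth_map (Ordinal d_lt)) // {2}(divn_eq i k).
    by rewrite (nthE (Ordinal d_lt)) ?ltn_pmod.
  split=> [/(congr1 (fun t => tnth t ord0)) | iz].
    rewrite tnth_mktuple tnth_map addn0 size_map modn_small // nth_i.
    by case=> <-.
  apply: eq_from_tnth => s; rewrite ord1 tnth_mktuple tnth_map addn0 size_map.
  by rewrite modn_small // nth_i; congr Some; apply: val_inj.
pose c := tnth z ord0.
have i_lt : c * k + j < size (blocks a k).
  rewrite size_v; apply: (@leq_trans (c.+1 * k)).
    by rewrite mulSn addnC ltn_add2r.
  by rewrite leq_mul2r ltn_ord orbT.
exists (Ordinal i_lt); split=> [|i [i_mod /windowE i_div]].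
  split; first by rewrite /= modnMDl.
  by apply/windowE; rewrite /= divnMDl // divn_small ?addn0.
apply/val_inj/(@eq_divn_modn k); last by rewrite i_mod /= modnMDl.
by rewrite i_div /= divnMDl // divn_small ?addn0.
Qed.

(** * Covering by the filled word *)

Theorem theorem9p1 (a n : nat) (u : pword a)
  (n_ge1 : 1 <= n)
  (size_u : n <= size u)
  (u_once : forall z : n.-tuple 'I_a, z \in covered n u -> covers_once u z)
  (u_window : forall i : 'I_(size u), count_mem None (window n u i) = 1) :
  let k := count_mem None u in
  let v := blocks a k in
  let w := fill (word_pow a u) v in
  [/\ k * n = size u,
      perfect_necklace 1 k v,
      total_word w
    & forall z : n.-tuple 'I_a, z \in covered n u -> covers_once w z].
Proof.
move=> k v w; split=> [|||z].
- exact: count_wildcards.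
- exact: blocks_perfect.
- exact: total_fill.
move/u_once=> [i [u_i i_unique]].
have L_gt0 : 0 < size u by exact: leq_trans size_u.
have a_gt0 : 0 < a by apply: leq_ltn_trans (ltn_ord (tnth z (Ordinal n_ge1))).
have [j0 j0P] := window_wildcard (u_window i).
(* [m] is the copy of [u] where the window has to start for its wildcard to fall
   in the copy number [z_j0]. *)
have [m m_lt [mP m_unique]] :=
  addn_modn_unique ((i + j0) %/ size u) (ltn_ord (tnth z j0)).
have div_q m' : (m' * size u + i + j0) %/ size u = m' + (i + j0) %/ size u.
  by rewrite -addnA divnMDl.
have q_lt : m * size u + i < size w.
  rewrite size_fill; apply: (@leq_trans (m.+1 * size u)).
    by rewrite mulSn addnC ltn_add2r.
  by rewrite leq_mul2r m_lt orbT.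
exists (Ordinal q_lt); split=> [|q].
  apply/(covers_at_fill z _ a_gt0 L_gt0); split=> [|j /eqP].
    by rewrite -covers_at_modn /= modnMDl modn_small.
  by rewrite /= -addnA modnMDl j0P addnA => /eqP->; rewrite div_q.
move/(covers_at_fill z _ a_gt0 L_gt0) => [u_q copy].
have q_mod : q %% size u = i.
  have := i_unique (Ordinal (ltn_pmod q L_gt0)).
  by rewrite /= covers_at_modn => /(_ u_q) ->.
have qE : q = q %/ size u * size u + i :> nat.
  by rewrite {1}(divn_eq q (size u)) q_mod.
have q_div : q %/ size u < a by rewrite ltn_divLR // -size_fill.
apply: val_inj; rewrite /= qE; congr (_ * _ + _); apply/esym/m_unique => //.
rewrite -div_q -qE copy //; apply/eqP.
by rewrite -modnDml q_mod j0P.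
Qed.
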